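(* Let $R$ be a nil-reversible ring. Then: (1) $R$ is abelian; (2) $R$ is 2-primal; (3) $R$ is weakly semicommutative.
   Context: All rings are associative with identity. For a ring $R$, $N(R)$ denotes the set of all nilpotent elements of $R$ and $P(R)$ denotes the prime radical of $R$. For $a\in R$, $l(a)=\{x\in R: xa=0\}$ and $r(a)=\{x\in R: ax=0\}$. A ring $R$ is nil-reversible if $l(a)=r(a)$ for every $a\in N(R)$. $R$ is abelian if every idempotent of $R$ is central. $R$ is 2-primal if $N(R)=P(R)$. $R$ is weakly semicommutative if for all $w,h\in R$, $wh=0$ implies $wrh\in N(R)$ for every $r\in R$. *)

(* Defs.v *)
From HB Require Import structures.
From mathcomp Require Import all_boot all_algebra.
From mathcomp Require Import classical_sets.

Set Implicit Arguments.
Unset Strict Implicit.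
Unset Printing Implicit Defensive.

Import GRing.Theory.
Local Open Scope classical_set_scope.
Local Open Scope ring_scope.

(* [pzRingType] is the structure of associative unital rings; the zero ring
   is allowed. *)

Section Definitions.
Variable R : pzRingType.
Implicit Types (a e r w h x : R) (A B I P : set R).

Definition nilpotents : set R :=
  [set a | exists n : nat, (0 < n)%N /\ a ^+ n = 0].

Definition left_annihilator a : set R := [set x | x * a = 0].

Definition right_annihilator a : set R := [set x | a * x = 0].

Definition two_sided_ideal I : Prop :=
  [/\ I 0,
      forall x y, I x -> I y -> I (x - y),
      forall r x, I x -> I (r * x) &
      forall r x, I x -> I (x * r)].

(* Primeness is in the noncommutative sense, quantifying over ideals.
   The ideal product AB is generated additively by the elements a * b, so
   AB is contained in the ideal P iff all these elements lie in P. *)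
Definition prime_ideal P : Prop :=
  [/\ two_sided_ideal P,
      P <> setT &
      forall A B, two_sided_ideal A -> two_sided_ideal B ->
        [set a * b | a in A & b in B] `<=` P -> A `<=` P \/ B `<=` P].

(* In the zero ring there is no prime ideal and the intersection is [setT]. *)
Definition prime_radical : set R :=
  \bigcap_(P in [set P | prime_ideal P]) P.

Definition nil_reversible : Prop :=
  forall a, nilpotents a -> left_annihilator a = right_annihilator a.

Definition abelian_ring : Prop :=
  forall e, e * e = e -> forall r, e * r = r * e.

Definition two_primal : Prop := nilpotents = prime_radical.

Definition weakly_semicommutative : Prop :=
  forall w h, w * h = 0 -> forall r, nilpotents (w * r * h).

End Definitions.

Arguments nilpotents R : clear implicits.
Arguments prime_radical R : clear implicits.

(* Main.v *)
Require Import Defs.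
From mathcomp Require Import all_boot all_algebra.
From mathcomp Require Import boolp classical_sets.

Set Implicit Arguments.
Unset Strict Implicit.
Unset Printing Implicit Defensive.

Import GRing.Theory.
Local Open Scope classical_set_scope.
Local Open Scope ring_scope.

(** Everything rests on one exchange: if [a] is nilpotent and [y * a = 0], then
    [r * y * a = 0] for every [r], and nil-reversibility moves [a] to the
    other side, giving [a * r * y = 0].  An arbitrary factor has thus been
    inserted after [a] ([nilrev_insert]).

    Abelian: for an idempotent [e], both [e * r * (1 - e)] and
    [(1 - e) * r * e] square to zero and are killed by [e] on one side, hence
    on the other side too, where [e] fixes them; so both vanish.

    Weakly semicommutative: if [w * h = 0] then [h * w] squares to zero, so
    [h * w * r * (h * w) = 0] by the exchange, and this product occurs inside
    [(w * r * h) ^+ 3].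

    2-primal: in every ring the prime radical is nil, because an ideal maximal
    among those avoiding the powers of a non-nilpotent element is prime
    ([prime_radical_nil]).  Conversely, iterating the exchange on [a ^+ n = 0]
    makes every product [a * r1 * a * r2 * ... * a * rn] vanish, and the
    elementwise form of primeness ([prime_ideal_elementwise]) then puts [a] in
    every prime ideal. *)

Section Rings.
Variable R : pzRingType.
Implicit Types (a e r w h x y : R) (A B I P : set R).

(** The ideals generated by [a] and [b] consist of finite sums.  Two residual
    ideals serve instead: the largest ideal [B] with [a R B] inside [P], which
    contains [b], and then the largest ideal [A] with [A R B] inside [P], which
    contains [a]. *)
Lemma prime_ideal_elementwise P a b :
  prime_ideal P -> (forall r, P (a * r * b)) -> P a \/ P b.
Proof.
move=> [[P0 PB PL PR] _ Pprime] aRb.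
pose B := [set y | forall r, P (a * r * y)].
pose A := [set x | forall r y, B y -> P (x * r * y)].
have idB : two_sided_ideal B.
  split=> [r | x y Bx By r | s x Bx r | s x Bx r].
  - by rewrite mulr0.
  - by rewrite mulrBr; apply: PB.
  - by rewrite mulrA -(mulrA a); apply: Bx.
  - by rewrite mulrA; apply/PR/Bx.
have idA : two_sided_ideal A.
  split=> [r y _ | x x' Ax Ax' r y By | s x Ax r y By | s x Ax r y By].
  - by rewrite !mul0r.
  - by rewrite !mulrBl; apply: PB; [apply: Ax | apply: Ax'].
  - by rewrite -!mulrA; apply: PL; rewrite mulrA; apply: Ax.
  - by rewrite -(mulrA x); apply: Ax.
have AB_P : [set x * y | x in A & y in B] `<=` P.
  by move=> _ [x Ax [y By <-]]; rewrite -[x]mulr1; apply: Ax.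
have Aa : A a by move=> r y By; apply: By.
by case: (Pprime A B idA idB AB_P) => sub; [left | right]; apply: sub.
Qed.

(** The condition [I 0] is left out so that the empty set, the union of the
    empty chain, qualifies for Zorn's lemma. *)
Definition ideal_avoiding_powers a I : Prop :=
  [/\ forall x y, I x -> I y -> I (x - y),
      forall r x, I x -> I (r * x),
      forall r x, I x -> I (x * r) &
      forall n, (0 < n)%N -> ~ I (a ^+ n)].

Lemma maximal_ideal_avoiding_powers a : ~ nilpotents R a ->
  exists P, [/\ two_sided_ideal P, forall n, (0 < n)%N -> ~ P (a ^+ n) &
    forall I, two_sided_ideal I -> P `<=` I -> ~ I `<=` P ->
      exists2 n, (0 < n)%N & I (a ^+ n)].
Proof.
move=> nilNa.
have [F chF totF|P [[PB PL PR Pa] Pmax]] :=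
    @Zorn_bigcup R (ideal_avoiding_powers a).
  split=> [x y [I FI Ix] [J FJ Jy] | r x [I FI Ix] | r x [I FI Ix]
          | n n_gt0 [I FI Ian]].
  - have [IJ|JI] := totF I J FI FJ.
      by exists J => //; have [+ _ _ _] := chF J FJ; apply => //; apply: IJ.
    by exists I => //; have [+ _ _ _] := chF I FI; apply => //; apply: JI.
  - by exists I => //; have [_ + _ _] := chF I FI; apply.
  - by exists I => //; have [_ _ + _] := chF I FI; apply.
  - by have [_ _ _ /(_ n n_gt0)] := chF I FI; apply.
(* A maximal element is nonempty because the zero ideal avoids the powers. *)
have P0 : P 0.
  apply: contrapT => nP0; apply: (Pmax [set 0]).
    split; first by move=> x Px; case: nP0; rewrite -(subrr x); apply: PB.
    by move=> /(_ 0 erefl).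
  split=> [x y -> -> | r x -> | r x -> | n n_gt0 an0] /=.
  - by rewrite subr0.
  - by rewrite mulr0.
  - by rewrite mul0r.
  - by apply: nilNa; exists n.
exists P; split=> // I [I0 IB IL IR] PI nIP; apply: contrapT => avoid.
apply: (Pmax I); first by split.
by split=> // n n_gt0 Ian; apply: avoid; exists n.
Qed.

Lemma ideal_sum P A : two_sided_ideal P -> two_sided_ideal A ->
  two_sided_ideal [set p + x | p in P & x in A].
Proof.
move=> [P0 PB PL PR] [A0 AB AL AR].
split=> [| _ _ [p Pp [x Ax <-]] [q Pq [y Ay <-]] | r _ [p Pp [x Ax <-]]
        | r _ [p Pp [x Ax <-]]].
- by exists 0 => //; exists 0 => //; rewrite addr0.
- exists (p - q); first exact: PB.
  by exists (x - y); [exact: AB | rewrite opprD addrACA].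
- exists (r * p); first exact: PL.
  by exists (r * x); [exact: AL | rewrite mulrDr].
- exists (p * r); first exact: PR.
  by exists (x * r); [exact: AR | rewrite mulrDl].
Qed.

(** A non-nilpotent [a] lies outside an ideal [P] maximal among those avoiding
    its powers.  Such a [P] is prime: if neither [A] nor [B] is inside [P],
    then [P + A] and [P + B] contain powers of [a], and the product of these
    powers lies in [P] as soon as [AB] does. *)
Lemma prime_radical_nil : prime_radical R `<=` nilpotents R.
Proof.
move=> a rad_a; apply: contrapT => /maximal_ideal_avoiding_powers.
move=> [P [idP Pa Pmax]]; apply: (Pa 1%N) => //; apply: rad_a => /=.
split=> // [PT | A B idA idB AB_P]; first by apply: (Pa 1%N); rewrite ?PT.
have [P0 PB PL PR] := idP.
have PD x y : P x -> P y -> P (x + y).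
  by move=> Px Py; rewrite -[y]opprK -(sub0r y); apply/PB/PB.
have pow I : two_sided_ideal I -> ~ I `<=` P ->
    exists n p x, [/\ (0 < n)%N, P p, I x & a ^+ n = p + x].
  move=> idI nIP; have [I0 _ _ _] := idI.
  have [||| n n_gt0 [p Pp [x Ix an]]] := Pmax [set p + x | p in P & x in I].
  - exact: ideal_sum.
  - by move=> p Pp; exists p => //; exists 0; rewrite ?addr0.
  - move=> sumP; apply: nIP => x Ix; apply: sumP.
    by exists 0 => //; exists x; rewrite ?add0r.
  - by exists n, p, x.
apply: contrapT => /not_orP[/(pow _ idA) + /(pow _ idB)].
move=> [m [p [x [m_gt0 Pp Ax am]]]] [n [q [y [_ Pq By an]]]].
apply: (Pa (m + n)%N); first by rewrite addn_gt0 m_gt0.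
rewrite exprD am an mulrDl; apply/PD; first exact/PR.
by rewrite mulrDr; apply/PD; [apply: PL | apply: AB_P; exists x => //; exists y].
Qed.

Lemma square_zero_nilpotent a : a * a = 0 -> nilpotents R a.
Proof. by move=> aa0; exists 2%N; rewrite expr2. Qed.

Hypothesis hR : nil_reversible R.

Lemma nilrevC a x : nilpotents R a -> x * a = 0 <-> a * x = 0.
Proof.
by move=> /hR annE; rewrite -[x * a = 0]/(left_annihilator a x) annE.
Qed.

Lemma nilrev_insert a r y : nilpotents R a -> y * a = 0 -> a * r * y = 0.
Proof.
move=> na ya0; rewrite -mulrA; apply: (nilrevC _ na).1.
by rewrite -mulrA ya0 mulr0.
Qed.

Lemma nilrev_abelian : abelian_ring R.
Proof.
move=> e ee r.
have eC : e * (1 - e) = 0 by rewrite mulrBr mulr1 ee subrr.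
have Ce : (1 - e) * e = 0 by rewrite mulrBl mul1r ee subrr.
have ere : e * r * (1 - e) = 0.
  have sq0 : nilpotents R (e * r * (1 - e)).
    by apply: square_zero_nilpotent; rewrite -!mulrA (mulrA _ e) Ce mul0r !mulr0.
  have : e * r * (1 - e) * e = 0 by rewrite -mulrA Ce mulr0.
  by move/(nilrevC e sq0); rewrite !mulrA ee.
have ere' : (1 - e) * r * e = 0.
  have sq0 : nilpotents R ((1 - e) * r * e).
    by apply: square_zero_nilpotent; rewrite -!mulrA (mulrA e) eC mul0r !mulr0.
  have : e * ((1 - e) * r * e) = 0 by rewrite !mulrA eC !mul0r.
  by move/(nilrevC e sq0) => <-; rewrite -[RHS]mulrA ee.
transitivity (e * r * e).
  by apply/eqP; rewrite -subr_eq0 -{1}[e * r]mulr1 -mulrBr ere.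
by apply/eqP; rewrite eq_sym -subr_eq0 -mulrA -{1}[r * e]mul1r -mulrBl mulrA ere'.
Qed.

(** The induction trades the powers of [a] on the right, one at a time, for
    factors [a * r] on the left, which primeness strips off. *)
Lemma nilpotent_power_prime P a k y : prime_ideal P -> nilpotents R a ->
  y * a ^+ k = 0 -> P a \/ P y.
Proof.
move=> primeP na; elim: k y => [|k IHk] y.
  by rewrite expr0 mulr1 => ->; right; have [[]] := primeP.
rewrite exprSr mulrA => yak0.
have [|nPa] := pselect (P a); first by left.
apply: prime_ideal_elementwise => // r.
by case: (IHk (a * r * y)) => //; rewrite -[LHS]mulrA; apply: nilrev_insert.
Qed.

Lemma nilrev_two_primal : two_primal R.
Proof.
apply/seteqP; split; last exact: prime_radical_nil.
move=> a na P primeP; have [n [_ an0]] := na.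
case: (@nilpotent_power_prime P a n 1) => //; first by rewrite mul1r.
by have [[_ _ PL _] _ _] := primeP => /(PL a); rewrite mulr1.
Qed.

Lemma nilrev_weakly_semicommutative : weakly_semicommutative R.
Proof.
move=> w h wh0 r; exists 3%N; split=> //.
have hw2 : h * w * (h * w) = 0 by rewrite mulrA -(mulrA h) wh0 mulr0 mul0r.
have := nilrev_insert r (square_zero_nilpotent hw2) hw2.
rewrite !exprS expr0 mulr1 => hwrhw0.
transitivity (w * r * (h * w * r * (h * w)) * r * h); first by rewrite !mulrA.
by rewrite hwrhw0 mulr0 !mul0r.
Qed.

End Rings.

Theorem proposition2p4 (R : pzRingType) (hR : nil_reversible R) :
  abelian_ring R /\ two_primal R /\ weakly_semicommutative R.
Proof.
split; first exact: nilrev_abelian.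
by split; [exact: nilrev_two_primal | exact: nilrev_weakly_semicommutative].
Qed.
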